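(* For a UC family $\mathcal{A}$ with $U(\mathcal{A})=[n]$ and $\emptyset\in\mathcal{A}$, nonemptiness of $Z(\mathcal{A})$ does not necessarily imply that there exists a feasible solution of $I^{\mathcal{A}}$. That is, there exist $n\ge1$ and a UC family $\mathcal{A}$ with $U(\mathcal{A})=[n]$ and $\emptyset\in\mathcal{A}$ such that $Z(\mathcal{A})\neq\emptyset$ but $I^{\mathcal{A}}$ has no feasible solution.
   Context: A UC (union-closed) family is a nonempty finite family $\mathcal{F}$ of distinct finite sets such that $A\cup B\in\mathcal{F}$ for all $A,B\in\mathcal{F}$. $[n]=\{1,\dots,n\}$, $\mathcal{P}([n])$ is its power set, $U(\mathcal{F})$ is the union of all sets in $\mathcal{F}$, $\mathcal{F}_i=\{F\in\mathcal{F} : i\in F\}$, and $\mathcal{A}\uplus\mathcal{B}=\{A\cup B : A\in\mathcal{A},B\in\mathcal{B}\}$. $Z(\mathcal{A})$ is the set of integer vectors $z\in\mathbb{Z}^n$ with $z_i\ge0$ for all $i\in[n]$, $\sum_{i\in[n]}z_i\ge1$, and, for each $j\in[n]$, with $\mathcal{B}=\mathcal{P}([n]\setminus\{j\})\uplus\mathcal{A}$, $$\sum_{S\in\mathcal{B}}\left(\sum_{i\in S}z_i-\sum_{i\notin S}z_i\right)\ge0$$ (where $i\notin S$ means $i\in[n]\setminus S$). $I^{\mathcal{A}}$ is the integer program of minimizing $\sum_{i\in[n]}z_i$ over $z\in\mathbb{Z}_{\ge0}^n$ subject to $\sum_{i\in[n]}z_i\ge1$ and $\sum_{i\in[n]}z_i|\mathcal{B}_i|\ge(|\mathcal{B}|/2)\sum_{i\in[n]}z_i$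 for every UC family $\mathcal{B}\subseteq\mathcal{P}([n])$ with $\mathcal{B}\uplus\mathcal{A}=\mathcal{B}$. A feasible solution is a vector $z\in\mathbb{Z}_{\ge0}^n$ satisfying all these constraints. *)

(* Defs.v *)
(* Mathematical Components.  The ground set [n] = {1, ..., n} is represented by
   'I_n = {0, ..., n.-1}, so that P([n]) is the type {set 'I_n} and every family
   contained in P([n]) is a (finite, duplicate-free) term of type
   {set {set 'I_n}}.  A vector of Z^n is a row vector z : 'rV[int]_n, whose i-th
   coordinate is written z 0 i. *)
From mathcomp Require Import all_boot all_order all_algebra.

Set Implicit Arguments.
Unset Strict Implicit.
Unset Printing Implicit Defensive.

Import Order.TTheory GRing.Theory Num.Theory.
Local Open Scope ring_scope.

Definition UC (T : finType) (F : {set {set T}}) : Prop :=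
  F != set0 /\ (forall A B : {set T}, A \in F -> B \in F -> A :|: B \in F).

Definition uplus (T : finType) (A B : {set {set T}}) : {set {set T}} :=
  [set X :|: Y | X in A, Y in B].

Definition star (T : finType) (F : {set {set T}}) (i : T) : {set {set T}} :=
  [set S in F | i \in S].

Definition in_Z (n : nat) (A : {set {set 'I_n}}) (z : 'rV[int]_n) : Prop :=
  [/\ forall i : 'I_n, 0 <= z 0 i,
      1 <= \sum_(i < n) z 0 i
    & forall j : 'I_n,
        0 <= \sum_(S in uplus (powerset ([set: 'I_n] :\ j)) A)
               (\sum_(i in S) z 0 i - \sum_(i | i \notin S) z 0 i)].

(* The objective function \sum_i z_i of the integer program plays no role in
   feasibility.  Only the last constraint involves the fraction |B| / 2, hence
   its cast to rat. *)
Definition feasible (n : nat) (A : {set {set 'I_n}}) (z : 'rV[int]_n) : Prop :=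
  [/\ forall i : 'I_n, 0 <= z 0 i,
      1 <= \sum_(i < n) z 0 i
    & forall B : {set {set 'I_n}}, UC B -> uplus B A = B ->
        (#|B|%:R / 2%:R) * (\sum_(i < n) z 0 i)%:~R
          <= \sum_(i < n) (z 0 i)%:~R * #|star B i|%:R :> rat].

(* Main.v *)
(* Feasibility for I^A passes to larger families, and a feasible vector for a
   UC family containing the empty set lies in its Z.  So it suffices to find
   UC families A \subset A' with Z(A) nonempty and Z(A') empty: nonemptiness of
   Z is not monotone.

   Split the ground set into M = {0, ..., 4} and C = {5, 6, 7}, and let A_0 be
   the family {}, 012, 0123, 0124, 0134, 0234, 01234, for which Z, computed on
   M, is empty, but only barely.  Both A (thin) and A' (thick) consist of A_0
   and sets containing C; in A' these are all the sets containing C, in A only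
   the sets C :|: X with X \subset M empty or of size at least 3.  In both
   cases the constraints at the points of C force z to vanish on C.  For A',
   what remains are the constraints of A_0 on M, which have no solution.  For
   A, each constraint at a point of M is 7 times the one of A_0 plus the one of
   the family of sets of size at least 3, and the surplus of the latter makes
   z = (5, 4, 4, 4, 4, 0, 0, 0) a solution. *)

Require Import Defs.
From mathcomp Require Import all_boot all_order all_algebra.
From mathcomp Require Import zify.

Set Implicit Arguments.
Unset Strict Implicit.
Unset Printing Implicit Defensive.

Import Order.TTheory GRing.Theory Num.Theory.
Local Open Scope ring_scope.

(** * Unions of two families *)

Section Uplus.

Variable T : finType.
Implicit Types (A B F : {set {set T}}) (S : {set T}).

Lemma uplusS B A A' : A \subset A' -> uplus B A \subset uplus B A'.
Proof.
move=> /subsetP sAA'; apply/subsetP => _ /imset2P[X Y XB YA ->].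
by apply: imset2_f => //; apply: sAA'.
Qed.

Lemma sub_uplus B A : set0 \in A -> B \subset uplus B A.
Proof.
by move=> A0; apply/subsetP => S SB; rewrite -[S]setU0; apply: imset2_f.
Qed.

Lemma UC_uplus B A : UC B -> UC A -> UC (uplus B A).
Proof.
move=> [/set0Pn[X XB] UB] [/set0Pn[Y YA] UA]; split.
  by apply/set0Pn; exists (X :|: Y); apply: imset2_f.
move=> _ _ /imset2P[X1 Y1 X1B Y1A ->] /imset2P[X2 Y2 X2B Y2A ->].
by rewrite setUACA; apply: imset2_f; [apply: UB | apply: UA].
Qed.

Lemma uplusK B A : UC A -> set0 \in A -> uplus (uplus B A) A = uplus B A.
Proof.
move=> [_ UA] A0; apply/eqP; rewrite eqEsubset sub_uplus // andbT.
apply/subsetP => _ /imset2P[_ Y /imset2P[X Y' XB Y'A ->] YA ->].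
by rewrite -setUA; apply: imset2_f => //; apply: UA.
Qed.

Lemma UC_powerset S : UC (powerset S).
Proof.
split; first by apply/set0Pn; exists set0; rewrite inE sub0set.
by move=> X Y; rewrite !inE subUset => -> ->.
Qed.

(** Only [j] has to come from the member of [A]; [S :\ j] supplies the rest of [S]. *)
Lemma mem_uplus_powersetD1 A j S :
  (S \in uplus (powerset ([set: T] :\ j)) A) =
  [exists X in A, (X \subset S) && ((j \in S) ==> (j \in X))].
Proof.
apply/imset2P/exists_inP => [[X Y] | [Y YA /andP[sYS jSY]]].
  rewrite inE => /subsetP sX YA ->; exists Y => //; rewrite subsetUr /= inE.
  by apply/implyP => /orP[/sX|//]; rewrite !inE eqxx.
exists (S :\ j) Y => //; first by rewrite inE setSD ?subsetT.
apply/setP => i; rewrite !inE; have [-> | _] /= := eqVneq i j.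
  by apply/idP/idP; [apply/implyP | apply: (subsetP sYS)].
by apply/idP/orP => [-> | [// | /(subsetP sYS)]]; first left.
Qed.

End Uplus.

(** * Coefficients of the constraints; feasibility versus [Z] *)

Definition excess (T : finType) (F : {set {set T}}) (i : T) : int :=
  #|star F i|%:Z *+ 2 - #|F|%:Z.

(** In the summand of [S], [z i] has coefficient 1 or -1 according to whether [i \in S]. Exchanging
    the sums leaves the members containing [i] minus those avoiding it, which is [excess F i]. *)
Lemma sum_weight_excess (T : finType) (F : {set {set T}}) (z : T -> int) :
  \sum_(S in F) (\sum_(i in S) z i - \sum_(i | i \notin S) z i) =
  \sum_i z i * excess F i.
Proof.
under eq_bigr => S _.
  rewrite (_ : _ - _ = \sum_i z i * ((i \in S)%:R *+ 2 - 1)); first over.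
  rewrite big_mkcond [X in _ - X]big_mkcond -sumrB; apply: eq_bigr => i _ /=.
  by case: (i \in S); rewrite /= ?mul0rn; lia.
rewrite exchange_big; apply: eq_bigr => i _ /=.
rewrite -mulr_sumr sumrB sumrMnl; congr (_ * (_ *+ 2 - _)).
  rewrite -natr_sum -[RHS]natz; congr _%:R.
  rewrite -sum1_card [RHS](eq_bigl _ _ (fun S => in_set _ S)).
  by rewrite [RHS]big_mkcondr; apply: eq_bigr => S _; case: (i \in S).
by rewrite sumr_const natz.
Qed.

(** The larger family imposes fewer constraints: if [uplus B A' = B], then [uplus B A] lies between
    [B] and [uplus B A']. *)
Lemma feasibleS n (A A' : {set {set 'I_n}}) z :
  set0 \in A -> A \subset A' -> feasible A z -> feasible A' z.
Proof.
move=> A0 sAA' [z_ge0 z_ge1 zB]; split=> // B UB BA'; apply: zB => //.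
apply/eqP; rewrite eqEsubset sub_uplus // andbT.
by rewrite -{2}BA' uplusS.
Qed.

(** For each [j], the family summed over in [in_Z] is one of the families [B] of the program, and
    twice its rational constraint is the integer one. *)
Lemma feasible_in_Z n (A : {set {set 'I_n}}) z :
  UC A -> set0 \in A -> feasible A z -> in_Z A z.
Proof.
move=> UA A0 [z_ge0 z_ge1 zB]; split=> // j.
set B := uplus _ A.
have := zB B (UC_uplus (UC_powerset _) UA) (uplusK _ UA A0).
rewrite sum_weight_excess -subr_ge0 -(ler0z rat) => zBj.
rewrite (_ : _%:~R = 2 *
  (\sum_(i < n) (z 0 i)%:~R * #|star B i|%:R -
   #|B|%:R / 2 * (\sum_(i < n) z 0 i)%:~R)) ?mulr_ge0 //.
rewrite mulrBr [X in _ - X]mulrA [2 * (_ / _)]mulrC divfK //.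
rewrite !raddf_sum /= !mulr_sumr -sumrB.
apply: eq_bigr => i _; rewrite /excess rmorphM rmorphB rmorphMn /= !pmulrn.
by rewrite mulrBr mulrnAr mulr_natl [X in _ - X]mulrC.
Qed.

(** * Subsets as bit sequences, for evaluation by [vm_compute] *)

Fixpoint bits n : seq bitseq :=
  if n is n'.+1 then
    map (cons false) (bits n') ++ map (cons true) (bits n')
  else [:: [::]].

Lemma mem_bits n s : (s \in bits n) = (size s == n).
Proof.
elim: n s => [|n IHn] [|b s] //=; rewrite mem_cat.
  by apply/norP; split; apply/mapP => -[].
have cons_inj c : injective (@cons bool c) by move=> x y [].
rewrite eqSS -IHn; case: b; rewrite (mem_map (cons_inj _)) ?orbF //.
  by rewrite orbC; case: (_ \in bits n) => //=; apply/mapP => -[].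
by case: (_ \in bits n) => //=; apply/mapP => -[].
Qed.

Lemma bits_uniq n : uniq (bits n).
Proof.
have cons_inj c : injective (@cons bool c) by move=> x y [].
elim: n => //= n IHn; rewrite cat_uniq !map_inj_uniq // IHn andbT /=.
by apply/hasPn => _ /mapP[s _ ->]; apply/mapP => -[].
Qed.

Section Encoding.

Variable n : nat.
Implicit Types (S X : {set 'I_n}) (p : pred bitseq).

Definition enc S : bitseq := [seq i \in S | i <- enum 'I_n].

Lemma size_enc S : size (enc S) = n.
Proof. by rewrite size_map size_enum_ord. Qed.

Lemma nth_enc S (i : 'I_n) : nth false (enc S) i = (i \in S).
Proof. by rewrite (nth_map i) ?size_enum_ord // nth_ord_enum. Qed.

Lemma enc_inj : injective enc.
Proof. by move=> S X eqSX; apply/setP => i; rewrite -!nth_enc eqSX. Qed.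

Lemma enc_set0 : enc set0 = nseq n false.
Proof.
apply: (@eq_from_nth _ false) => [|k]; rewrite size_enc ?size_nseq // => ltkn.
by rewrite (nth_enc _ (Ordinal ltkn)) in_set0 nth_nseq ltkn.
Qed.

Lemma enc_setT : enc setT = nseq n true.
Proof.
apply: (@eq_from_nth _ false) => [|k]; rewrite size_enc ?size_nseq // => ltkn.
by rewrite (nth_enc _ (Ordinal ltkn)) in_setT nth_nseq ltkn.
Qed.

Lemma enc_surj s : size s = n -> exists S, s = enc S.
Proof.
move=> sz; exists [set i : 'I_n | nth false s i].
apply: (@eq_from_nth _ false) => [|k]; rewrite ?size_enc // sz => ltkn.
by rewrite (nth_enc _ (Ordinal ltkn)) inE.
Qed.

Lemma card_enc p : #|[set S | p (enc S)]| = count p (bits n).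
Proof.
rewrite cardsE cardE size_filter -enumT -(count_map enc p).
apply/permP; apply: uniq_perm; rewrite ?bits_uniq //.
  by rewrite (map_inj_uniq enc_inj) enum_uniq.
move=> s; rewrite mem_bits; apply/mapP/eqP => [[S _ ->] | ].
  by rewrite size_enc.
by move=> /enc_surj[S ->]; exists S; rewrite ?mem_enum.
Qed.

Definition orbits (s t : bitseq) := [seq u.1 || u.2 | u <- zip s t].

Definition subbits (s t : bitseq) := all (fun u => u.1 ==> u.2) (zip s t).

Lemma encU S X : enc (S :|: X) = orbits (enc S) (enc X).
Proof.
rewrite /orbits /enc zip_map -map_comp; by apply: eq_map => i; rewrite in_setU.
Qed.

Lemma enc_sub S X : (S \subset X) = subbits (enc S) (enc X).
Proof.
rewrite /subbits /enc zip_map all_map; apply/subsetP/allP => /= sSX i.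
  by move=> _; apply/implyP; apply: sSX.
by have /implyP := sSX i (mem_enum _ i).
Qed.

Definition family p : {set {set 'I_n}} := [set S | p (enc S)].

Definition members p := filter p (bits n).

Lemma mem_members p S : (enc S \in members p) = (S \in family p).
Proof. by rewrite mem_filter mem_bits size_enc eqxx andbT inE. Qed.

Lemma UC_family p :
  set0 \in family p ->
  all (fun s => all (fun t => p (orbits s t)) (members p)) (members p) ->
  UC (family p).
Proof.
move=> p0 /allP pU; split; first by apply/set0Pn; exists set0.
move=> S X; rewrite -(mem_members p S) -(mem_members p X) => Sp Xp.
by rewrite inE encU (allP (pU _ Sp)).
Qed.

(* The [let] outside the abstraction makes [vm_compute] enumerate the family
   once per cut rather than once per bit sequence. *)
Definition cut p (j : nat) : pred bitseq :=
  let A := members p in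
  fun s => has (fun a => subbits a s && (nth false s j ==> nth false a j)) A.

Lemma cutE p (j : 'I_n) :
  uplus (powerset ([set: 'I_n] :\ j)) (family p) = family (cut p j).
Proof.
apply/setP => S; rewrite mem_uplus_powersetD1 inE.
apply/exists_inP/hasP => [[X XA XS] | [s]].
  by exists (enc X); rewrite ?mem_members // -enc_sub !nth_enc.
move=> sp; have /enc_surj[X eq_s] : size s = n.
  by move: sp; rewrite mem_filter mem_bits => /andP[_ /eqP].
rewrite eq_s -enc_sub !nth_enc => XS; exists X => //.
by rewrite -mem_members -eq_s.
Qed.

Definition cut_excess p (j i : nat) : int :=
  let B := filter (cut p j) (bits n) in
  (count (fun s => nth false s i) B)%:Z *+ 2 - (size B)%:Z.

Lemma excess_cut p (j i : 'I_n) :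
  excess (uplus (powerset ([set: 'I_n] :\ j)) (family p)) i =
  cut_excess p j i.
Proof.
rewrite cutE /excess /cut_excess /family card_enc size_filter count_filter.
rewrite (_ : star _ i =
  [set S | [predI (fun s => nth false s i) & cut p j] (enc S)]) ?card_enc //.
by apply/setP => S; rewrite !inE andbC -nth_enc.
Qed.

End Encoding.

(** * Computing [Z], and the two families on eight points *)

Lemma in_Z_family n p z :
  in_Z (family n p) z <->
  [/\ forall i, 0 <= z 0 i, 1 <= \sum_i z 0 i &
      forall j : 'I_n, 0 <= \sum_i z 0 i * cut_excess n p j i].
Proof.
have cutZ (j : 'I_n) :
    \sum_(S in uplus (powerset ([set: 'I_n] :\ j)) (family n p))
    (\sum_(i in S) z 0 i - \sum_(i | i \notin S) z 0 i) =
    \sum_i z 0 i * cut_excess n p j i.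
  rewrite (sum_weight_excess _ (z 0)); apply: eq_bigr => i _.
  by rewrite excess_cut.
by split=> -[z_ge0 z_ge1 zB]; split=> // j; have := zB j; rewrite cutZ.
Qed.

(** This is A_0: the second alternative gives 012, 0123, 0124 and 01234, the third adds 0134 and
    0234. *)
Definition base (s : bitseq) : bool :=
  ~~ has id (drop 5 s) &&
  [|| ~~ has id s, all id (take 3 s) | nth false s 0 && (count id s == 4)].

(** The counts include the three points of C. *)
Definition thin (s : bitseq) : bool :=
  base s || all id (drop 5 s) && ((count id s == 3) || (5 < count id s)%N).

Definition thick (s : bitseq) : bool := base s || all id (drop 5 s).

Lemma UC_thin : UC (family 8 thin).
Proof. by apply: UC_family; [rewrite inE enc_set0 | vm_compute]. Qed.

Lemma UC_thick : UC (family 8 thick).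
Proof. by apply: UC_family; [rewrite inE enc_set0 | vm_compute]. Qed.

Lemma thin_sub_thick : family 8 thin \subset family 8 thick.
Proof.
apply/subsetP => S; rewrite !inE /thin /thick.
by case/orP => [-> // | /andP[-> _]]; rewrite orbT.
Qed.

Lemma cover_thin : cover (family 8 thin) = [set: 'I_8].
Proof.
apply/setP => i; rewrite inE; apply/bigcupP.
by exists setT; rewrite inE ?enc_setT.
Qed.

Lemma table_nth n (f : nat -> nat -> int) t :
  [seq [seq f j i | i <- iota 0 n] | j <- iota 0 n] = t ->
  forall i j : 'I_n, f j i = nth 0 (nth [::] t j) i.
Proof.
by move=> <- i j; rewrite !(nth_map 0%N, nth_iota, size_map, size_iota).
Qed.

(** Row [j] is the constraint at [j]. For [j] in C the cut consists of the sets that avoid [j] or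
    contain C; the last three rows add up to -32 times the sum of z over C. *)
Definition thin_excess : seq (seq int) :=
  [:: [:: -75; 31; 31; 17; 17; 5; 5; 5];
    [:: 38; -82; 24; 10; 10; 6; 6; 6];
    [:: 38; 24; -82; 10; 10; 6; 6; 6];
    [:: 31; 17; 17; -89; 17; 7; 7; 7];
    [:: 31; 17; 17; 17; -89; 7; 7; 7];
    [:: 0; 0; 0; 0; 0; -96; 32; 32];
    [:: 0; 0; 0; 0; 0; 32; -96; 32];
    [:: 0; 0; 0; 0; 0; 32; 32; -96]].

Lemma cut_excess_thin (i j : 'I_8) :
  cut_excess 8 thin j i = nth 0 (nth [::] thin_excess j) i.
Proof. by apply: table_nth; vm_compute. Qed.

(** For [j] in M, the cut has all sets containing C, which cancel on M; its other sets join one of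
    the 7 proper subsets of C to a set in the cut of A_0. Hence the entries on M are 7 times those
    of A_0. *)
Definition thick_excess : seq (seq int) :=
  [:: [:: -70; 28; 28; 14; 14; 10; 10; 10];
    [:: 35; -77; 21; 7; 7; 11; 11; 11];
    [:: 35; 21; -77; 7; 7; 11; 11; 11];
    [:: 28; 14; 14; -84; 14; 12; 12; 12];
    [:: 28; 14; 14; 14; -84; 12; 12; 12];
    [:: 0; 0; 0; 0; 0; -96; 32; 32];
    [:: 0; 0; 0; 0; 0; 32; -96; 32];
    [:: 0; 0; 0; 0; 0; 32; 32; -96]].

Lemma cut_excess_thick (i j : 'I_8) :
  cut_excess 8 thick j i = nth 0 (nth [::] thick_excess j) i.
Proof. by apply: table_nth; vm_compute. Qed.

Lemma in_Z_thin :
  in_Z (family 8 thin) (\row_i nth 0 [:: 5; 4; 4; 4; 4; 0; 0; 0] i).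
Proof.
apply/in_Z_family; split=> [i | | j].
- by rewrite mxE; case: i => -[|[|[|[|[|[|[|[|]]]]]]]].
- by rewrite !big_ord_recl big_ord0 !mxE.
under eq_bigr => i _ do rewrite mxE cut_excess_thin.
rewrite !big_ord_recl big_ord0.
(* The eight sums are 9, 38, 38, 3, 3, 0, 0, 0. *)
by case: j => -[|[|[|[|[|[|[|[|//]]]]]]]].
Qed.

Lemma Z_thick_empty z : ~ in_Z (family 8 thick) z.
Proof.
move=> /in_Z_family[z_ge0 z_ge1 zB].
have {}zB k (ltk8 : (k < 8)%N) :
    0 <= \sum_i z 0 i * nth 0 (nth [::] thick_excess k) i.
  by have := zB (Ordinal ltk8); under eq_bigr do rewrite cut_excess_thick.
move: (zB 0%N isT) (zB 1%N isT) (zB 2%N isT) (zB 3%N isT).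
move: (zB 4%N isT) (zB 5%N isT) (zB 6%N isT) (zB 7%N isT) z_ge1.
(* With weights (73, 51, 51, 26, 26, 80, 80, 80) the eight inequalities add up
   to [0 <= -84 * \sum_i z 0 i]. *)
rewrite !big_ord_recl !big_ord0 /=; lia.
Qed.

Theorem corollary6 :
  exists (n : nat) (A : {set {set 'I_n}}),
    [/\ (1 <= n)%N,
        UC A /\ cover A = [set: 'I_n],
        set0 \in A,
        (exists z : 'rV[int]_n, in_Z A z)
      & ~ (exists z : 'rV[int]_n, feasible A z)].
Proof.
have thin0 : set0 \in family 8 thin by rewrite inE enc_set0.
have thick0 : set0 \in family 8 thick by rewrite inE enc_set0.
exists 8, (family 8 thin); split=> //.
- by split; [apply: UC_thin | apply: cover_thin].
- by eexists; apply: in_Z_thin.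
case=> z /(feasibleS thin0 thin_sub_thick) /(feasible_in_Z UC_thick thick0).
exact: Z_thick_empty.
Qed.
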